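(* Let $L = U + E_8(-1)$ with isometry group $\mathrm{O}(L)$. The minimal norm $h^2$ of a vector $h \in L$ whose stabilizer $\{g \in \mathrm{O}(L) \mid g(h) = h\}$ is trivial equals $1240$, and, up to the action of $\mathrm{O}(L)$, there is a unique vector of norm $1240$ in $L$ with trivial stabilizer.
   Context: $U$ denotes the hyperbolic plane (the even unimodular lattice of rank $2$ with Gram matrix $\begin{pmatrix}0&1\\1&0\end{pmatrix}$), $E_8(-1)$ is the negative definite $E_8$-lattice, and $+$ denotes the orthogonal direct sum; thus $L = U+E_8(-1)$ is the even unimodular lattice of signature $(1,9)$. The norm of $h\in L$ is $h^2 = (h,h)$. $\mathrm{O}(L)$ is the group of all isometries of $L$. *)

(* Defs.v *)
From HB Require Import structures.
From mathcomp Require Import all_boot all_order all_algebra.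

Set Implicit Arguments.
Unset Strict Implicit.
Unset Printing Implicit Defensive.

Import Order.TTheory GRing.Theory Num.Theory.
Local Open Scope ring_scope.

Definition U_gram : 'M[int]_2 := \matrix_(i, j) (i != j)%:R.

(* The E8 Dynkin diagram: the chain 0 - 1 - ... - 6 with node 7 attached to
   node 2 (arms of 2, 4 and 1 nodes). *)
Definition E8_edges : seq (nat * nat) :=
  [:: (0, 1); (1, 2); (2, 3); (3, 4); (4, 5); (5, 6); (2, 7)]%N.

(* The Gram matrix of the positive definite E8-lattice in a basis of simple
   roots. *)
Definition E8_gram : 'M[int]_8 :=
  \matrix_(i, j)
    if i == j then 2
    else if ((i : nat, j : nat) \in E8_edges)
            || ((j : nat, i : nat) \in E8_edges) then -1
    else 0.

Definition L_gram : 'M[int]_(2 + 8) := block_mx U_gram 0 0 (- E8_gram).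

Notation L := 'rV[int]_(2 + 8).

Definition Lform (x y : L) : int := (x *m L_gram *m y^T) 0 0.

Definition Lnorm (x : L) : int := Lform x x.

Definition in_OL (g : {linear L -> L}) : Prop :=
  bijective g /\ forall x y : L, Lform (g x) (g y) = Lform x y.

Definition trivial_stabilizer (h : L) : Prop :=
  forall g : {linear L -> L}, in_OL g -> g h = h -> forall x : L, g x = x.

(* Main.v *)
Require Import Defs.
From HB Require Import structures.
From mathcomp Require Import all_boot all_order all_algebra.
From mathcomp Require Import zify ring.

Import Order.TTheory GRing.Theory Num.Theory.
Local Open Scope ring_scope.

(** The roots of L (vectors of norm -2) contain ten simple roots whose Dynkin
    diagram is T(2,3,7), the affine diagram of E8 with one more node.  As L is
    unimodular there is a Weyl vector rho, with (rho, r) = 1 for every simple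
    root r; its norm is 1240.  Call x dominant if (x, r) >= 0 for every simple
    root r.

    Lower bound and uniqueness.  If h has positive norm, then up to the sign
    h lies in the same half of the light cone as rho.  Reflections in simple
    roots move it within that half, and as long as it is not dominant one of
    them lowers (h, rho), which stays positive: so the orbit of h contains a
    dominant vector h' [forward_dominant].  A simple root r with (h', r) = 0
    would give a reflection fixing h', so if the stabilizer of h is trivial
    then (h', r) >= 1 for all r, that is, h' = rho + d with d dominant.  The
    inverse of the Gram matrix of the simple roots has nonnegative entries, so
    dominant vectors have nonnegative products [dominant_Lform_ge0], and
    h'^2 = 1240 + 2 (rho, d) + d^2 >= 1240, with equality only for d = 0
    [weyl_vector_minimal].

    Vectors of norm <= 0.  They never have a trivial stabilizer
    [nonpositive_stabilizer].  By a rational form of the four-square theorem,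
    E8(-1) tensored with Q contains a vector z with z^2 = h^2, and this yields
    an isotropic vector e orthogonal to h [isotropic_orthogonal].  Unipotent
    isometries attached to e (Eichler transvections) then fix h.

    The stabilizer of rho is trivial [weyl_vector_stabilizer].  Call (x, rho)
    the height of x.  The nonzero dominant vector of smallest height is the null
    root delta of the affine subdiagram, of height 30, and the next height is at
    least 60.  Retracing the descent to a dominant vector, one finds that in
    the closed half-cone of rho the vectors of height 30, ..., 37 form a
    single chain, one for each height, the differences being the simple roots
    met when walking down the long arm of the diagram to its branch node
    [forward_chain].  An isometry fixing rho therefore fixes eight vectors
    besides rho.  The nine vectors leave one degree of freedom, which
    integrality excludes: it would have to exchange the neighbours of the
    branch node on its two short arms, which have different lengths. *)

(** * Coordinates *)

Notation "x `[ k ]" := (fun_of_matrix x ord0 (inord k : 'I_(2 + 8)))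
  (at level 1, format "x `[ k ]").

Definition vec (s : seq int) : L := \row_j nth 0 s j.

Lemma sum_coords (F : 'I_(2 + 8) -> int) :
  \sum_i F i = F (inord 0) + F (inord 1) + F (inord 2) + F (inord 3)
    + F (inord 4) + F (inord 5) + F (inord 6) + F (inord 7) + F (inord 8)
    + F (inord 9).
Proof.
rewrite !big_ord_recl big_ord0 addr0 !addrA.
by do !congr (_ + _); congr F; apply: val_inj; rewrite /= ?inordK.
Qed.

Lemma L_gram_entry (i j : nat) : (i < 10)%N -> (j < 10)%N ->
  L_gram (inord i) (inord j) =
  nth 0 (nth [::]
    [:: [:: 0; 1; 0; 0; 0; 0; 0; 0; 0; 0];
        [:: 1; 0; 0; 0; 0; 0; 0; 0; 0; 0];
        [:: 0; 0; -2; 1; 0; 0; 0; 0; 0; 0];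
        [:: 0; 0; 1; -2; 1; 0; 0; 0; 0; 0];
        [:: 0; 0; 0; 1; -2; 1; 0; 0; 0; 1];
        [:: 0; 0; 0; 0; 1; -2; 1; 0; 0; 0];
        [:: 0; 0; 0; 0; 0; 1; -2; 1; 0; 0];
        [:: 0; 0; 0; 0; 0; 0; 1; -2; 1; 0];
        [:: 0; 0; 0; 0; 0; 0; 0; 1; -2; 0];
        [:: 0; 0; 0; 0; 1; 0; 0; 0; 0; -2]] i) j.
Proof.
move=> i10 j10; rewrite /L_gram.
case: (splitP (inord i : 'I_(2+8))) => a; rewrite inordK // => Ea;
case: (splitP (inord j : 'I_(2+8))) => b; rewrite inordK // => Eb.
- have -> : inord i = lshift 8 a by apply: val_inj; rewrite /= inordK.
  have -> : inord j = lshift 8 b by apply: val_inj; rewrite /= inordK.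
  rewrite block_mxEul mxE {}Ea {}Eb {i10 j10}.
  by case: a => [] [|[|[]]] //= ?; case: b => [] [|[|[]]].
- have -> : inord i = lshift 8 a by apply: val_inj; rewrite /= inordK.
  have -> : inord j = rshift 2 b by apply: val_inj; rewrite /= inordK.
  rewrite block_mxEur mxE {}Ea {}Eb {i10 j10}.
  by case: a => [] [|[|[]]] //= ?; case: b => [] [|[|[|[|[|[|[|[|[]]]]]]]]].
- have -> : inord i = rshift 2 a by apply: val_inj; rewrite /= inordK.
  have -> : inord j = lshift 8 b by apply: val_inj; rewrite /= inordK.
  rewrite block_mxEdl mxE {}Ea {}Eb {i10 j10}.
  by case: b => [] [|[|[]]] //= ?; case: a => [] [|[|[|[|[|[|[|[|[]]]]]]]]].
- have -> : inord i = rshift 2 a by apply: val_inj; rewrite /= inordK.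
  have -> : inord j = rshift 2 b by apply: val_inj; rewrite /= inordK.
  rewrite block_mxEdr !mxE {}Ea {}Eb {i10 j10}.
  by case: a => [] [|[|[|[|[|[|[|[|[]]]]]]]]] //= ?;
     case: b => [] [|[|[|[|[|[|[|[|[]]]]]]]]].
Qed.

Lemma LformE (x y : L) : Lform x y =
  x`[0] * y`[1] + x`[1] * y`[0]
  + x`[2] * (y`[3] - 2 * y`[2]) + x`[3] * (y`[2] - 2 * y`[3] + y`[4])
  + x`[4] * (y`[3] - 2 * y`[4] + y`[5] + y`[9])
  + x`[5] * (y`[4] - 2 * y`[5] + y`[6])
  + x`[6] * (y`[5] - 2 * y`[6] + y`[7]) + x`[7] * (y`[6] - 2 * y`[7] + y`[8])
  + x`[8] * (y`[7] - 2 * y`[8]) + x`[9] * (y`[4] - 2 * y`[9]).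
Proof.
have rowE i : (i < 10)%N -> (L_gram *m y^T) (inord i) ord0 =
    \sum_j L_gram (inord i) j * y ord0 j.
  by move=> _; rewrite mxE; apply: eq_bigr => j _; rewrite [y^T _ _]mxE.
rewrite /Lform -mulmxA mxE sum_coords !rowE // !sum_coords.
do ?[rewrite L_gram_entry //; cbn [nth]].
ring.
Qed.

Lemma LformC (x y : L) : Lform x y = Lform y x.
Proof. by rewrite !LformE; ring. Qed.

Lemma LformDl (x y z : L) : Lform (x + y) z = Lform x z + Lform y z.
Proof. by rewrite /Lform !mulmxDl mxE. Qed.

Lemma LformZl (a : int) (x y : L) : Lform (a *: x) y = a * Lform x y.
Proof. by rewrite /Lform -!scalemxAl mxE. Qed.

Lemma LformDr (x y z : L) : Lform z (x + y) = Lform z x + Lform z y.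
Proof. by rewrite !(LformC z) LformDl. Qed.

Lemma LformZr (a : int) (x y : L) : Lform x (a *: y) = a * Lform x y.
Proof. by rewrite !(LformC x) LformZl. Qed.

Definition Lform_lin := (LformDl, LformDr, LformZl, LformZr).

Lemma vec_coord (s : seq int) k : (k < 10)%N -> (vec s)`[k] = nth 0 s k.
Proof. by move=> k10; rewrite mxE inordK. Qed.

Definition coordE := (vec_coord, mxE).

Lemma coord_inj (x y : L) : (forall k, (k < 10)%N -> x`[k] = y`[k]) -> x = y.
Proof.
move=> xy; apply/rowP => k.
by rewrite -[k]inord_val; apply: xy.
Qed.

(** * Simple roots and the Weyl vector *)

(** Coordinates 0 and 1 refer to U, coordinates 2, ..., 9 to the simple roots
    of E8.  Root 1 is the affine root of E8: the null vector (0, 1) of U minus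
    the highest root.  The diagram is the chain 0 - 1 - 8 - 7 - 6 - 5 - 4, whose
    end 4 is the branch node; the short arms are 3 - 2 and 9. *)
Definition simple_root (i : nat) : L := vec (nth [::]
  [:: [:: 1; -1; 0; 0; 0; 0; 0; 0; 0; 0];
      [:: 0; 1; -2; -4; -6; -5; -4; -3; -2; -3];
      [:: 0; 0; 1; 0; 0; 0; 0; 0; 0; 0];
      [:: 0; 0; 0; 1; 0; 0; 0; 0; 0; 0];
      [:: 0; 0; 0; 0; 1; 0; 0; 0; 0; 0];
      [:: 0; 0; 0; 0; 0; 1; 0; 0; 0; 0];
      [:: 0; 0; 0; 0; 0; 0; 1; 0; 0; 0];
      [:: 0; 0; 0; 0; 0; 0; 0; 1; 0; 0];
      [:: 0; 0; 0; 0; 0; 0; 0; 0; 1; 0];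
      [:: 0; 0; 0; 0; 0; 0; 0; 0; 0; 1]] i).

(** As L is unimodular, the labels of a vector are its coordinates in the basis
    of fundamental weights, dual to the simple roots. *)
Definition label (x : L) (i : nat) : int := Lform x (simple_root i).

Lemma labelE (x : L) i : label x i = nth 0
  [:: x`[1] - x`[0]; x`[0] + x`[8]; x`[3] - 2 * x`[2];
      x`[2] - 2 * x`[3] + x`[4]; x`[3] - 2 * x`[4] + x`[5] + x`[9];
      x`[4] - 2 * x`[5] + x`[6]; x`[5] - 2 * x`[6] + x`[7];
      x`[6] - 2 * x`[7] + x`[8]; x`[7] - 2 * x`[8]; x`[4] - 2 * x`[9]] i.
Proof.
rewrite /label LformE.
case: (ltnP i 10) => [|i10]; last first.
  by rewrite !vec_coord // !nth_default //=; ring.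
by rewrite !vec_coord //; move: i; do 10! (case; first by move=> _ /=; ring).
Qed.

(** The sum of the fundamental weights; its E8 part is minus the Weyl vector
    of E8. *)
Definition weyl_vector : L :=
  vec [:: 30; 31; -46; -91; -135; -110; -84; -57; -29; -68].

Definition height (x : L) : int := Lform x weyl_vector.

Lemma heightE (x : L) : height x =
  31 * x`[0] + 30 * x`[1] + x`[2] + x`[3] + x`[4] + x`[5] + x`[6] + x`[7]
  + x`[8] + x`[9].
Proof. by rewrite /height LformE !vec_coord //=; ring. Qed.

Lemma height_simple_root i : (i < 10)%N -> height (simple_root i) = 1.
Proof.
by move=> i10; rewrite /height LformC -/(label _ _) labelE !vec_coord //=;
   move: i i10; do 10! case=> //.
Qed.

Lemma norm_weyl_vector : Lnorm weyl_vector = 1240.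
Proof. by rewrite /Lnorm -/(height _) heightE !vec_coord. Qed.

Lemma norm_simple_root i : (i < 10)%N -> Lnorm (simple_root i) = - 2.
Proof.
by move=> i10; rewrite /Lnorm -/(label _ _) labelE !vec_coord //=;
   move: i i10; do 10! case=> //.
Qed.

(** * The Weyl vector has negative definite complement *)

(** The positive definite norm of the E8 component. *)
Definition E8norm (x : L) : int := 2 * x`[0] * x`[1] - Lnorm x.

(** Completing the square from the end of each arm of the E8 diagram towards
    the branch node, coordinate 4. *)
Lemma E8norm_sos (x : L) : 60 * E8norm x =
  30 * (2 * x`[2] - x`[3]) ^+ 2 + 10 * (3 * x`[3] - 2 * x`[4]) ^+ 2
  + 30 * (2 * x`[8] - x`[7]) ^+ 2 + 10 * (3 * x`[7] - 2 * x`[6]) ^+ 2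
  + 5 * (4 * x`[6] - 3 * x`[5]) ^+ 2 + 3 * (5 * x`[5] - 4 * x`[4]) ^+ 2
  + 30 * (2 * x`[9] - x`[4]) ^+ 2 + 2 * x`[4] ^+ 2.
Proof. by rewrite /E8norm /Lnorm LformE; ring. Qed.

Lemma E8norm_ge0 (x : L) : 0 <= E8norm x.
Proof.
rewrite -(pmulr_rge0 _ (_ : 0 < 60)) // E8norm_sos.
by rewrite !addr_ge0 // mulr_ge0 // sqr_ge0.
Qed.

Lemma sqr_le0 (a : int) : a ^+ 2 <= 0 -> a = 0.
Proof. by move=> a0; apply/eqP; rewrite -sqrf_eq0 eq_le a0 sqr_ge0. Qed.

Lemma E8norm_le0 (x : L) : E8norm x <= 0 ->
  forall k, (2 <= k < 10)%N -> x`[k] = 0.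
Proof.
move=> x0; have: 60 * E8norm x <= 0 by rewrite pmulr_rle0.
have squares_eq0 (a b c d e f g h : int) :
    30 * a ^+ 2 + 10 * b ^+ 2 + 30 * c ^+ 2 + 10 * d ^+ 2 + 5 * e ^+ 2
    + 3 * f ^+ 2 + 30 * g ^+ 2 + 2 * h ^+ 2 <= 0 ->
    [/\ a = 0, b = 0, c = 0 & d = 0] /\ [/\ e = 0, f = 0, g = 0 & h = 0].
  move=> le0.
  suff [] : [/\ a ^+ 2 <= 0, b ^+ 2 <= 0, c ^+ 2 <= 0 & d ^+ 2 <= 0] /\
    [/\ e ^+ 2 <= 0, f ^+ 2 <= 0, g ^+ 2 <= 0 & h ^+ 2 <= 0].
    by do 2 case=> /sqr_le0 -> /sqr_le0 -> /sqr_le0 -> /sqr_le0 ->.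
  move: (sqr_ge0 a) (sqr_ge0 b) (sqr_ge0 c) (sqr_ge0 d) (sqr_ge0 e)
    (sqr_ge0 f) (sqr_ge0 g) (sqr_ge0 h) le0.
  move: (a ^+ 2) (b ^+ 2) (c ^+ 2) (d ^+ 2) (e ^+ 2) (f ^+ 2) (g ^+ 2) (h ^+ 2).
  by clear=> *; split; split; lia.
rewrite E8norm_sos => /squares_eq0 [] [].
move=> e23 e34 e87 e76 [e65 e54 e94 e4].
have e3 : x`[3] = 0 by move: e34 e4; clear; lia.
have e2 : x`[2] = 0 by move: e23 e3; clear; lia.
have e5 : x`[5] = 0 by move: e54 e4; clear; lia.
have e6 : x`[6] = 0 by move: e65 e5; clear; lia.
have e7 : x`[7] = 0 by move: e76 e6; clear; lia.
have e8 : x`[8] = 0 by move: e87 e7; clear; lia.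
have e9 : x`[9] = 0 by move: e94 e4; clear; lia.
by do 10! case=> //.
Qed.

(** * Isometries *)

Lemma in_OL_comp (f g : {linear L -> L}) :
  in_OL f -> in_OL g -> in_OL (f \o g : {linear L -> L}).
Proof.
move=> [bf If] [bg Ig]; split; first exact: bij_comp.
by move=> x y; rewrite /= If Ig.
Qed.

Lemma in_OL_inv (g : {linear L -> L}) : in_OL g ->
  exists f : {linear L -> L}, [/\ in_OL f, cancel g f & cancel f g].
Proof.
move=> [[f gK fK] Ig].
have f_lin : linear f by exact: (can2_linear gK fK).
pose Hf := GRing.isLinear.Build int L L *:%R f f_lin.
pose F : {linear L -> L} := HB.pack f Hf.
exists F; split=> //; split; first by exists g.
by move=> x y; rewrite -Ig; congr Lform; apply: fK.
Qed.

Lemma in_OL_opp : in_OL (-%R : {linear L -> L}).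
Proof.
split; first by exists (fun x : L => - x) => x /=; rewrite opprK.
by move=> x y /=; rewrite -!scaleN1r !Lform_lin; ring.
Qed.

Lemma trivial_stabilizer_isometry (g : {linear L -> L}) h :
  in_OL g -> trivial_stabilizer h -> trivial_stabilizer (g h).
Proof.
move=> Og triv f Of fgh x.
have [g' [Og' gK g'K]] := in_OL_inv _ Og.
have OF : in_OL (g' \o (f \o g) : {linear L -> L}).
  by apply: in_OL_comp => //; apply: in_OL_comp.
have Fh : (g' \o (f \o g) : {linear L -> L}) h = h by rewrite /= fgh gK.
by have /= := triv _ OF Fh (g' x); rewrite g'K => /(congr1 g); rewrite !g'K.
Qed.

Definition reflection (r x : L) : L := x + Lform x r *: r.

Lemma reflection_linear r : linear (reflection r).
Proof.
move=> a x y; rewrite /reflection !Lform_lin scalerDl scalerDr scalerA.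
by rewrite addrACA.
Qed.
HB.instance Definition _ r :=
  GRing.isLinear.Build int L L *:%R (reflection r) (reflection_linear r).

Lemma reflectionK r : Lnorm r = - 2 -> involutive (reflection r).
Proof.
move=> norm_r x; rewrite /reflection !Lform_lin -/(Lnorm r) norm_r.
rewrite -addrA -scalerDl.
have -> : Lform x r + (Lform x r + Lform x r * - 2) = 0 by ring.
by rewrite scale0r addr0.
Qed.

Lemma in_OL_reflection r : Lnorm r = - 2 -> in_OL (reflection r).
Proof.
move=> norm_r; split; first by exists (reflection r); apply: reflectionK.
move=> x y; rewrite /reflection !Lform_lin -/(Lnorm r) norm_r (LformC r y).
ring.
Qed.

(** A reversed Cauchy-Schwarz inequality.  Write x = (a, b) + f with (a, b) in
    U and f in E8(-1), and let S be the product of f with the Weyl vector of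
    E8, whose norm is 620.  If (x, rho) = 0 then (31 a + 30 b)^2 = S^2, which
    the Cauchy-Schwarz inequality in E8 bounds by 620 |f|^2, hence by 1240 a b
    as x^2 >= 0; but (31 a + 30 b)^2 >= 3720 a b, so a b = 0, f = 0 and
    31 a + 30 b = 0. *)
Lemma height_eq0 (x : L) : 0 <= Lnorm x -> height x = 0 -> x = 0.
Proof.
move=> x0 h0.
set S : int := x`[2] + x`[3] + x`[4] + x`[5] + x`[6] + x`[7] + x`[8] + x`[9].
have CS : S ^+ 2 <= 620 * E8norm x.
  (* The plus sign is that of Cauchy-Schwarz: the E8 part of rho is minus the
     Weyl vector of E8. *)
  have := E8norm_ge0 (620 *: x + S *: weyl_vector).
  suff -> : E8norm (620 *: x + S *: weyl_vector)
      = 620 * (620 * E8norm x - S ^+ 2).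
    by rewrite pmulr_rge0 // subr_ge0.
  by rewrite /E8norm /Lnorm !LformE !coordE /= // /S; ring.
have hE : 31 * x`[0] + 30 * x`[1] = - S.
  by move: h0; rewrite heightE /S; clear; lia.
have sq : S ^+ 2 = (31 * x`[0] - 30 * x`[1]) ^+ 2 + 3720 * (x`[0] * x`[1]).
  by rewrite -sqrrN -hE; ring.
have En : E8norm x <= 2 * (x`[0] * x`[1]).
  by rewrite /E8norm mulrA; move: x0; clear; lia.
have E0 := E8norm_ge0 x.
have s0 := sqr_ge0 (31 * x`[0] - 30 * x`[1]).
have E8_0 : E8norm x <= 0.
  move: CS sq En E0 s0; clear.
  move: (E8norm x) (S ^+ 2) (_ ^+ 2) (x`[0] * x`[1]) => e s t p; lia.
have t0 : 31 * x`[0] - 30 * x`[1] = 0.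
  apply: sqr_le0; move: CS sq En E0 s0; clear.
  move: (E8norm x) (S ^+ 2) (_ ^+ 2) (x`[0] * x`[1]) => e s t p; lia.
have fx := E8norm_le0 _ E8_0.
have S0 : S = 0 by rewrite /S !fx.
apply: coord_inj => k k10; rewrite mxE.
case: k k10 => [|[|k]] k10; last by apply: fx.
- by move: hE t0; rewrite S0; clear; lia.
- by move: hE t0; rewrite S0; clear; lia.
Qed.

(** * Reduction to dominant vectors *)

Lemma heightD (x y : L) : height (x + y) = height x + height y.
Proof. exact: LformDl. Qed.

Lemma heightZ a (x : L) : height (a *: x) = a * height x.
Proof. exact: LformZl. Qed.

Lemma Lnorm_comb a b (x y : L) : Lnorm (a *: x + b *: y) =
  a ^+ 2 * Lnorm x + 2 * a * b * Lform x y + b ^+ 2 * Lnorm y.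
Proof. by rewrite /Lnorm !Lform_lin (LformC y x); ring. Qed.

(** The closed half of the light cone that contains the Weyl vector, without
    its apex. *)
Definition forward (x : L) := 0 <= Lnorm x /\ 0 < height x.

(** The segment from x to its reflection y lies in the closed light cone, since
    (x, y) = x^2 + (x, r)^2 >= 0; were the heights of x and y of opposite signs,
    it would meet the orthogonal of the Weyl vector, which is negative
    definite. *)
Lemma forward_reflection i (x : L) : (i < 10)%N ->
  forward x -> forward (reflection (simple_root i) x).
Proof.
move=> i10 [x0 hx]; set r := simple_root i; set y := reflection r x.
have r2 : Lnorm r = - 2 by exact: norm_simple_root.
have y2 : Lnorm y = Lnorm x by apply: (in_OL_reflection r r2).2.
split; first by rewrite y2.
have xy : Lform x y = Lnorm x + Lform x r ^+ 2.
  by rewrite /y /reflection !Lform_lin expr2.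
rewrite ltNge; apply/negP => hy.
have hyE : height y = height x + Lform x r.
  by rewrite heightD heightZ height_simple_root // mulr1.
(* The multiple of the crossing point that clears denominators. *)
pose w := - height y *: x + height x *: y.
have hw : height w = 0 by rewrite heightD !heightZ; ring.
have w2 : Lnorm w = (height y - height x) ^+ 2 * Lnorm x
    + 2 * (- height y) * height x * Lform x r ^+ 2.
  by rewrite Lnorm_comb y2 xy; ring.
have [hy0|hy0] := eqVneq (height y) 0.
  have yz : y = 0 by apply: height_eq0; rewrite ?y2.
  have xz : x = 0 by rewrite -(reflectionK r r2 x) -/y yz linear0.
  by move: hx; rewrite xz heightE !mxE.
have xr : 0 < Lform x r ^+ 2.
  rewrite lt_neqAle sqr_ge0 andbT eq_sym sqrf_eq0; apply/eqP => xr0.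
  by move: hy hx; rewrite hyE xr0; clear; lia.
have w_gt0 : 0 < Lnorm w.
  rewrite w2 ltr_wpDl //; first by rewrite mulr_ge0 // sqr_ge0.
  by rewrite (mulr_gt0 _ xr) // !mulr_gt0 // oppr_gt0 lt_neqAle hy0.
have w0 : w = 0 by apply: height_eq0; rewrite // ltW.
by move: w_gt0; rewrite w0 /Lnorm LformE !mxE.
Qed.

Definition dominant (x : L) := forall i, (i < 10)%N -> 0 <= label x i.

Lemma dominantPn (x : L) :
  dominant x \/ exists2 i, (i < 10)%N & label x i < 0.
Proof.
have [/allP pos|] := boolP (all (fun i => 0 <= label x i) (iota 0 10)).
  by left=> i i10; apply: pos; rewrite mem_iota.
rewrite -has_predC => /hasP[i]; rewrite mem_iota => i10 /= neg.
by right; exists i; rewrite // ltNge.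
Qed.

(** The reflection in a simple root r with (x, r) < 0 lowers the height by
    - (x, r), and heights are positive integers, so the descent stops. *)
Lemma forward_dominant (x : L) : forward x ->
  exists g : {linear L -> L},
    [/\ in_OL g, forward (g x), dominant (g x) & height (g x) <= height x].
Proof.
have [n] := ubnP `|height x|%N; elim: n x => // n IH x hn fx.
have [dx|[i i10 xi]] := dominantPn x.
  by exists idfun; split=> //; split=> //; exists idfun.
have fy := forward_reflection _ _ i10 fx.
have hy : height (reflection (simple_root i) x) = height x + label x i.
  by rewrite heightD heightZ height_simple_root // mulr1.
have {}hn : (`|height (reflection (simple_root i) x)| < n)%N.
  by case: fx fy => _ hx [_]; move: hn hx xi; rewrite hy; clear; lia.
have [g [Og fg dg hg]] := IH _ hn fy.
exists (g \o reflection (simple_root i)); split=> //.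
  by apply: in_OL_comp => //; apply/in_OL_reflection/norm_simple_root.
by apply: le_trans hg _; rewrite hy gerDl ltW.
Qed.

(** * Dominant vectors *)

(** The coordinates in the basis of simple roots, which are also the products
    with the fundamental weights. *)
Definition coef (x : L) (i : nat) : int := nth 0
  [:: x`[0]; x`[0] + x`[1]; x`[2] + 2 * (x`[0] + x`[1]);
      x`[3] + 4 * (x`[0] + x`[1]); x`[4] + 6 * (x`[0] + x`[1]);
      x`[5] + 5 * (x`[0] + x`[1]); x`[6] + 4 * (x`[0] + x`[1]);
      x`[7] + 3 * (x`[0] + x`[1]); x`[8] + 2 * (x`[0] + x`[1]);
      x`[9] + 3 * (x`[0] + x`[1])] i.

Lemma Lform_coef (x y : L) :
  Lform x y = \sum_(0 <= i < 10) coef x i * label y i.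
Proof.
rewrite LformE; do 10! (rewrite big_nat_recl //).
rewrite big_geq //.
by rewrite !labelE /coef /=; ring.
Qed.

(** The coefficients are the heights of the fundamental weights. *)
Lemma height_label (x : L) : height x =
  30 * label x 0 + 61 * label x 1 + 76 * label x 2 + 153 * label x 3
  + 231 * label x 4 + 195 * label x 5 + 160 * label x 6 + 126 * label x 7
  + 93 * label x 8 + 115 * label x 9.
Proof. by rewrite heightE !labelE /=; ring. Qed.

(** The fundamental weights are nonnegative combinations of the simple roots:
    the inverse of their Gram matrix has nonnegative entries. *)
Lemma dominant_coef_ge0 (x : L) i : dominant x -> 0 <= coef x i.
Proof.
move=> dx; have [i10|i10] := ltnP i 10; last by rewrite /coef nth_default.
move: (dx 0%N isT) (dx 1%N isT) (dx 2%N isT) (dx 3%N isT) (dx 4%N isT)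
  (dx 5%N isT) (dx 6%N isT) (dx 7%N isT) (dx 8%N isT) (dx 9%N isT).
rewrite !labelE /coef /=.
by move: i i10; clear; do 10! (case=> [_ /=|]; first by lia).
Qed.

Lemma dominant_Lform_ge0 (x y : L) : dominant x -> dominant y -> 0 <= Lform x y.
Proof.
move=> dx dy; rewrite Lform_coef big_seq sumr_ge0 // => i.
rewrite mem_index_iota => i10.
by rewrite mulr_ge0 ?dominant_coef_ge0 // dy.
Qed.

Lemma label_eq0 (x : L) : (forall i, (i < 10)%N -> label x i = 0) -> x = 0.
Proof.
move=> x0; apply: coord_inj => k k10; rewrite mxE.
move: (x0 0%N isT) (x0 1%N isT) (x0 2%N isT) (x0 3%N isT) (x0 4%N isT)
  (x0 5%N isT) (x0 6%N isT) (x0 7%N isT) (x0 8%N isT) (x0 9%N isT).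
rewrite !labelE /=.
by move: k k10; clear; do 10! (case=> [_ /=|]; first by lia).
Qed.

Lemma dominant_height_lt30 (x : L) : dominant x -> height x < 30 -> x = 0.
Proof.
move=> dx hx; apply: label_eq0 => i i10; move: hx; rewrite height_label.
move: (dx 0%N isT) (dx 1%N isT) (dx 2%N isT) (dx 3%N isT) (dx 4%N isT)
  (dx 5%N isT) (dx 6%N isT) (dx 7%N isT) (dx 8%N isT) (dx 9%N isT).
move: (label x) => l; clear -i10.
by move: i i10; do 10! (case=> [_ /=|]; first by lia).
Qed.

(** * The stabilizer of the Weyl vector *)

Definition chain_coords : seq (seq int) :=
  [:: [:: 0; 1;  0;  0;  0;  0;  0;  0;  0;  0];
      [:: 1; 0;  0;  0;  0;  0;  0;  0;  0;  0];
      [:: 1; 1; -2; -4; -6; -5; -4; -3; -2; -3];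
      [:: 1; 1; -2; -4; -6; -5; -4; -3; -1; -3];
      [:: 1; 1; -2; -4; -6; -5; -4; -2; -1; -3];
      [:: 1; 1; -2; -4; -6; -5; -3; -2; -1; -3];
      [:: 1; 1; -2; -4; -6; -4; -3; -2; -1; -3];
      [:: 1; 1; -2; -4; -5; -4; -3; -2; -1; -3]].

(** The null root of the affine subdiagram, to which the simple roots
    0, 1, 8, 7, 6, 5, 4 of the long arm are added one after the other. *)
Definition chain (m : nat) : L := vec (nth [::] chain_coords m).

Lemma height_chain m : (m < 8)%N -> height (chain m) = 30 + m%:Z.
Proof.
by rewrite heightE !vec_coord //; move: m; do 8! (case=> [_ //|]).
Qed.

Lemma norm_chain m : (m < 8)%N -> Lnorm (chain m) = 0.
Proof.
by rewrite /Lnorm LformE !vec_coord //; move: m; do 8! (case=> [_ //|]).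
Qed.

Definition chain_node (m : nat) : nat := nth 0%N [:: 0; 1; 8; 7; 6; 5; 4]%N m.

Lemma chainS m : (m < 7)%N ->
  chain m.+1 = chain m + simple_root (chain_node m).
Proof.
move=> m7; apply: coord_inj => k k10; rewrite !mxE !inordK //.
by move: m m7 k k10; do 7! (case=> [_|]; first by do 10! case=> //).
Qed.

(** The formula of [labelE] on explicit coordinates, in a form that
    computes. *)
Definition seq_label (s : seq int) (i : nat) : int := nth 0
  [:: s`_1 - s`_0; s`_0 + s`_8; s`_3 - 2 * s`_2; s`_2 - 2 * s`_3 + s`_4;
      s`_3 - 2 * s`_4 + s`_5 + s`_9; s`_4 - 2 * s`_5 + s`_6;
      s`_5 - 2 * s`_6 + s`_7; s`_6 - 2 * s`_7 + s`_8; s`_7 - 2 * s`_8;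
      s`_4 - 2 * s`_9] i.

Lemma label_vec s i : label (vec s) i = seq_label s i.
Proof. by rewrite labelE !vec_coord. Qed.

(** Only one simple root can raise a vector of the chain, and it leads to the
    next one; the chain would branch after its last vector. *)
Lemma label_chain m i : (m < 7)%N -> (i < 10)%N -> 0 < label (chain m) i ->
  i = chain_node m /\ label (chain m) i = 1.
Proof.
rewrite /chain label_vec => m7 i10 pos.
have : all (fun m => all (fun i =>
  let c := seq_label (nth [::] chain_coords m) i in
  (0 < c) ==> (i == chain_node m) && (c == 1)) (iota 0 10)) (iota 0 7).
  by vm_compute.
move/allP/(_ m); rewrite mem_iota => /(_ m7)/allP/(_ i).
by rewrite mem_iota /= pos => /(_ i10) /andP[/eqP -> /eqP ->].
Qed.

Lemma chain_step m i : (m < 7)%N -> (i < 10)%N -> 0 < label (chain m) i ->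
  reflection (simple_root i) (chain m) = chain m.+1.
Proof.
move=> m7 i10 /(label_chain _ _ m7 i10) [ei e1].
by rewrite chainS // /reflection -/(label _ _) e1 scale1r ei.
Qed.

(** Sixty is twice the smallest height, that of the null root, and the other
    fundamental weights have height at least 61. *)
Lemma dominant_height_lt60 (x : L) : dominant x -> 0 < height x < 60 ->
  x = chain 0.
Proof.
move=> dx /andP[hx_gt0 hx_lt60].
have x0 : 1 <= label x 0%N.
  move: hx_gt0 hx_lt60; rewrite height_label.
  move: (dx 0%N isT) (dx 1%N isT) (dx 2%N isT) (dx 3%N isT) (dx 4%N isT)
    (dx 5%N isT) (dx 6%N isT) (dx 7%N isT) (dx 8%N isT) (dx 9%N isT).
  by move: (label x) => l; clear; lia.
have label_sub i : (i < 10)%N ->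
    label (x + -1 *: chain 0) i = label x i - (i == 0%N)%:Z.
  move=> i10; rewrite /label !Lform_lin -!/(label _ _) mulN1r.
  by rewrite [label (chain 0) i]labelE !vec_coord //;
     move: i i10; do 10! case=> //.
apply/eqP; rewrite -subr_eq0 -scaleN1r; apply/eqP/dominant_height_lt30.
  move=> i i10; rewrite label_sub // subr_ge0.
  by case: i i10 => [|i] // i10; apply: dx.
by rewrite heightD heightZ height_chain //; move: hx_lt60; clear; lia.
Qed.

Lemma forward_height_ge30 (x : L) : forward x -> 30 <= height x.
Proof.
move=> /forward_dominant [g [_ [_ hg] dg]]; apply: le_trans.
rewrite leNgt; apply/negP => lt30.
have : height (g x) = 30.
  by rewrite (dominant_height_lt60 _ dg) ?height_chain //;
     move: hg lt30; clear; lia.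
by move: lt30; clear; lia.
Qed.

(** The height determines the vector: undoing the last step of the descent to
    a dominant vector is possible in one way only. *)
Lemma forward_chain m (x : L) : (m < 8)%N ->
  forward x -> height x = 30 + m%:Z -> x = chain m.
Proof.
elim/ltn_ind: m x => m IH x m8 fx hx.
have [dx|[i i10 xi]] := dominantPn x.
  have xE : x = chain 0.
    by apply: dominant_height_lt60 => //; rewrite hx; move: m8; clear; lia.
  suff -> : m = 0%N by [].
  by move: hx; rewrite xE height_chain //; clear; lia.
set r := simple_root i; pose y := reflection r x.
have fy : forward y by apply: forward_reflection.
have hy : height y = height x + label x i.
  by rewrite heightD heightZ height_simple_root // mulr1.
have := forward_height_ge30 _ fy; rewrite hy hx => y30.
have [m' mm' hm'] : exists2 m', (m' < m)%N & height y = 30 + m'%:Z.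
  exists `|height y - 30|%N; move: xi y30; rewrite hy hx; clear; lia.
have yE : y = chain m' by apply: IH => //; apply: ltn_trans m8.
have r2 : Lnorm r = - 2 by apply: norm_simple_root.
have yi : label y i = - label x i.
  by rewrite /label !Lform_lin -/r -/(Lnorm r) r2; ring.
have xE : x = chain m'.+1.
  rewrite -[x](reflectionK r r2) -/y yE chain_step //; first by lia.
  by rewrite -yE yi oppr_gt0.
suff -> : m = m'.+1 by [].
by move: hx; rewrite xE height_chain; move: mm' m8; clear; lia.
Qed.

(** An isometry fixing the Weyl vector preserves heights and the half-cone, so
    it fixes each vector of the chain and hence the simple roots of the long
    arm. *)
Lemma weyl_vector_stabilizer : trivial_stabilizer weyl_vector.
Proof.
move=> g [_ Ig] grho.
have height_g x : height (g x) = height x by rewrite /height -{1}grho Ig.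
have g_chain m : (m < 8)%N -> g (chain m) = chain m.
  move=> m8; apply: forward_chain; rewrite ?height_g ?height_chain //.
  by split; rewrite ?height_g ?height_chain // /Lnorm Ig -/(Lnorm _) norm_chain.
have g_root m : (m < 7)%N ->
    g (simple_root (chain_node m)) = simple_root (chain_node m).
  move=> m7; apply: (@addrI _ (chain m)).
  rewrite -chainS // -{1}(g_chain m) ?ltnS 1?ltnW // -linearD.
  by rewrite -chainS ?g_chain.
(* The fixed vectors have rank nine; roots 3 and 9 are the neighbours of the
   branch node on the two short arms. *)
have line x : let t := (g x)`[3] - x`[3] in
    g x = x + t *: (simple_root 3 - simple_root 9).
  have label_g m : (m < 7)%N ->
      label (g x) (chain_node m) = label x (chain_node m).
    by move=> m7; rewrite /label -{1}(g_root m m7) Ig.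
  have delta_g : Lform (g x) (chain 0) = Lform x (chain 0).
    by rewrite -{1}(g_chain 0%N isT) Ig.
  move=> t; apply: coord_inj => k k10; rewrite /t.
  move: (label_g 0%N isT) (label_g 1%N isT) (label_g 2%N isT) (label_g 3%N isT)
    (label_g 4%N isT) (label_g 5%N isT) (label_g 6%N isT) delta_g (height_g x).
  rewrite !labelE !LformE !vec_coord // !heightE !mxE !inordK //=.
  move: (g x) => y; clear -k10.
  by move: k k10; do 10! (case=> [_ /=|]; first by lia).
(* The norm forces 2 t = 0 or 2 t = 1 for the end of the arm of length two. *)
have g2 : g (simple_root 2) = simple_root 2.
  move: (line (simple_root 2)) => /=; set t := _ - _ => e.
  have : Lnorm (g (simple_root 2)) = - 2.
    by rewrite /Lnorm Ig -/(Lnorm _) norm_simple_root.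
  rewrite {1}e -[X in X + _]scale1r Lnorm_comb.
  have -> : Lnorm (simple_root 3 - simple_root 9) = - 4.
    by rewrite /Lnorm LformE !coordE.
  have -> : Lform (simple_root 2) (simple_root 3 - simple_root 9) = 1.
    by rewrite LformE !coordE.
  rewrite norm_simple_root // => tE.
  suff t0 : t = 0 by rewrite e t0 scale0r addr0.
  by move: tE; clear; nia.
move=> x; move: (line x) => /=; set t := _ - _ => e.
suff t0 : t = 0 by rewrite e t0 scale0r addr0.
have : Lform (g x) (simple_root 2) = Lform x (simple_root 2).
  by rewrite -{1}g2 Ig.
rewrite e !Lform_lin -scaleN1r Lform_lin.
have -> : Lform (simple_root 3) (simple_root 2) = 1.
  by rewrite LformE !vec_coord.
have -> : Lform (simple_root 9) (simple_root 2) = 0.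
  by rewrite LformE !vec_coord.
by clear; lia.
Qed.

(** * Sums of four rational squares *)

Definition sum4sq (n : int) :=
  exists a b c d : int, n = a ^+ 2 + b ^+ 2 + c ^+ 2 + d ^+ 2.

(** Euler's identity: the norm of quaternions is multiplicative. *)
Lemma sum4sqM (m n : int) : sum4sq m -> sum4sq n -> sum4sq (m * n).
Proof.
move=> [a [b [c [d ->]]]] [e [f [g [h ->]]]].
exists (a * e + b * f + c * g + d * h), (a * f - b * e + c * h - d * g),
  (a * g - c * e + d * f - b * h), (a * h - d * e + b * g - c * f).
ring.
Qed.

(** The squares i^2 and the elements - (j^2 + 1) with 0 <= i, j <= (p - 1) / 2
    are too many to be distinct modulo p, and within each family they are
    distinct.  The bound on i and j gives m < p. *)
Lemma dvd_sum2sq_add1 p : prime p -> odd p ->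
  exists i j m : nat, [/\ (0 < m)%N, (m < p)%N & (i ^ 2 + j ^ 2 + 1 = m * p)%N].
Proof.
move=> pr_p odd_p; pose h := p./2.
have ph : p = h.*2.+1 by rewrite -[LHS]odd_double_half odd_p.
have chp : p \in [pchar 'F_p] by apply: pchar_Fp.
pose f (u : 'I_h.+1 + 'I_h.+1) : 'F_p :=
  match u with inl i => (i ^ 2)%:R | inr j => - (j ^ 2 + 1)%:R end.
have [inj_f|/injectivePn[u [v neq_uv fuv]]] := boolP (injectiveb f).
  have := leq_card f (injectiveP _ inj_f).
  by rewrite (card_Fp pr_p) card_sum !card_ord ph -addnn; lia.
have sq_inj (i j : 'I_h.+1) : (i ^ 2)%:R = (j ^ 2)%:R :> 'F_p -> i = j.
  move=> /eqP; rewrite !natrX eqf_sqr => ij.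
  apply: val_inj => /=; move: (ltn_ord i) (ltn_ord j) => i_h j_h.
  case/orP: ij => [/eqP/(congr1 val)|].
    by rewrite /= !val_Fp_nat // !modn_small // ph -addnn; lia.
  rewrite -subr_eq0 opprK -natrD -(dvdn_pcharf chp).
  by move/dvdn_leq; rewrite ph -addnn; lia.
have cross (i j : 'I_h.+1) : (i ^ 2)%:R = - (j ^ 2 + 1)%:R :> 'F_p ->
    exists i j m : nat,
      [/\ (0 < m)%N, (m < p)%N & (i ^ 2 + j ^ 2 + 1 = m * p)%N].
  move=> e; have /dvdnP[m mE] : (p %| i ^ 2 + j ^ 2 + 1)%N.
    by rewrite (dvdn_pcharf chp) -addnA natrD e addNr.
  exists i, j, m; split=> //; first by case: m mE => //; lia.
  have h1 : (1 < p)%N by exact: prime_gt1.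
  rewrite -(ltn_pmul2r (ltnW h1)) -mE.
  have ih : (i ^ 2 <= h ^ 2)%N by rewrite leq_exp2r // -ltnS.
  have jh : (j ^ 2 <= h ^ 2)%N by rewrite leq_exp2r // -ltnS.
  by move: ih jh h1; rewrite ph -addnn -!mulnn; clear; nia.
case: u v neq_uv fuv => [i|i] [j|j] /= neq_uv e.
- by case/eqP: neq_uv; rewrite (sq_inj _ _ e).
- exact: cross e.
- exact: cross (esym e).
- move/oppr_inj: e; rewrite !natrD => /addIr /sq_inj eij.
  by case/eqP: neq_uv; rewrite eij.
Qed.

(** Allowing denominators makes Lagrange's descent a plain induction: if
    m p = i^2 + j^2 + 1 with m < p, then p m^2 is the product of m and m p. *)
Lemma sum4sq_rational (n : nat) :
  exists2 k : nat, (0 < k)%N & sum4sq (n%:Z * k%:Z ^+ 2).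
Proof.
elim/ltn_ind: n => n IH.
have [n2|n2] := ltnP n 2.
  exists 1%N => //; exists n%:Z, 0, 0, 0.
  by case: n n2 {IH} => [|[|]].
have [pr_n|] := boolP (prime n); last first.
  move/primePn => [|[d /andP[d1 dn] /dvdnP[e nE]]].
    by move: n2; clear; lia.
  have [k k0 sk] := IH d dn.
  have [|l l0 sl] := IH e.
    by rewrite nE; move: d1 n2; rewrite nE; clear; nia.
  exists (k * l)%N; first by rewrite muln_gt0 k0.
  have -> : n%:Z * (k * l)%:Z ^+ 2 = (d%:Z * k%:Z ^+ 2) * (e%:Z * l%:Z ^+ 2).
    by rewrite nE !PoszM; ring.
  exact: sum4sqM.
have [odd_n|even_n] := boolP (odd n); last first.
  exists 1%N => //; exists 1, 1, 0, 0.
  by case/even_prime: pr_n even_n => [->|->].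
have [i [j [m [m0 mn mE]]]] := dvd_sum2sq_add1 _ pr_n odd_n.
have [k k0 sk] := IH m mn.
exists (m * k)%N; first by rewrite muln_gt0 m0.
have -> : n%:Z * (m * k)%:Z ^+ 2 = (m%:Z * k%:Z ^+ 2) * (m * n)%:Z.
  by rewrite !PoszM; ring.
apply: sum4sqM sk _; rewrite -mE; exists i%:Z, j%:Z, 1, 0.
by rewrite -!mulnn !PoszD !PoszM; ring.
Qed.

(** * Vectors of nonpositive norm *)

(** An Eichler transvection, for e isotropic and b orthogonal to e; doubling b
    in the usual formula removes the half of its norm. *)
Definition transvection (e b x : L) : L :=
  x + (2 * Lform x e) *: b - (2 * Lform x b + 2 * Lnorm b * Lform x e) *: e.

Lemma transvection_linear e b : linear (transvection e b).
Proof.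
move=> a x y; apply: coord_inj => k k10; rewrite /transvection !Lform_lin !mxE.
ring.
Qed.
HB.instance Definition _ e b :=
  GRing.isLinear.Build int L L *:%R (transvection e b)
    (transvection_linear e b).

Lemma Lform_transvection e b x y : Lform (transvection e b x) y =
  Lform x y + 2 * Lform x e * Lform b y
  - (2 * Lform x b + 2 * Lnorm b * Lform x e) * Lform e y.
Proof. by rewrite /transvection -scaleNr !Lform_lin mulNr. Qed.

Lemma transvection_isometry e b x y : Lnorm e = 0 -> Lform e b = 0 ->
  Lform (transvection e b x) (transvection e b y) = Lform x y.
Proof.
rewrite {1}/Lnorm => ee eb.
rewrite Lform_transvection 3!(LformC _ (transvection e b y)).
rewrite !Lform_transvection /Lnorm ee eb (LformC b e) eb.
by rewrite (LformC b x) (LformC e x) (LformC y x); ring.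
Qed.

Lemma transvectionK e b : Lnorm e = 0 -> Lform e b = 0 ->
  cancel (transvection e b) (transvection e (- b)).
Proof.
rewrite {1}/Lnorm => ee eb.
have inv y : transvection e (- b) y =
    y - (2 * Lform y e) *: b + (2 * Lform y b - 2 * Lnorm b * Lform y e) *: e.
  rewrite /transvection /Lnorm -scaleN1r !Lform_lin.
  by apply: coord_inj => k k10; rewrite !mxE; ring.
move=> x; rewrite inv !Lform_transvection /Lnorm ee eb (LformC b e) eb.
by apply: coord_inj => k k10; rewrite !mxE; ring.
Qed.

Lemma in_OL_transvection e b : Lnorm e = 0 -> Lform e b = 0 ->
  in_OL (transvection e b).
Proof.
move=> e0 eb; split; last by move=> x y; apply: transvection_isometry.
exists (transvection e (- b)); first exact: transvectionK.
have eNb : Lform e (- b) = 0 by rewrite -scaleN1r LformZr eb mulr0.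
by have := transvectionK _ _ e0 eNb; rewrite opprK.
Qed.

Definition delta : L := chain 0.

(** Four mutually orthogonal roots of a D4 subdiagram of E8, the roots 3, 5, 9
    and the highest root of D4, turn sums of four squares into norms.  The roots
    7 and 8 are orthogonal to this D4. *)
Lemma E8_rational_norms (n : nat) : exists2 k : nat, (0 < k)%N &
  exists z : L, [/\ Lnorm z = - n%:Z * k%:Z ^+ 2, Lform z delta = 0,
    Lform z (simple_root 7) = 0 & Lform z (simple_root 8) = 0].
Proof.
have [k k0 [a [b [c [d kE]]]]] := sum4sq_rational (2 * n).
exists (2 * k)%N; first by rewrite muln_gt0.
exists (vec [:: 0; 0; 0; a + d; 2 * d; b + d; 0; 0; 0; c + d]).
have kE' : n%:Z * (2 * k)%N%:Z ^+ 2 = 2 * (a ^+ 2 + b ^+ 2 + c ^+ 2 + d ^+ 2).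
  by rewrite -kE !PoszM; ring.
split; rewrite /Lnorm ?mulNr ?kE' LformE !vec_coord //=; ring.
Qed.

(** If h is orthogonal to delta, take e = delta.  Otherwise let z in E8(-1)
    satisfy z^2 = k^2 h^2 and put w = k h + z.  The vector
    e = 2 (w, delta) w - w^2 delta is isotropic, being - w^2 times the image of
    delta under the reflection in w, or a multiple of w if w^2 = 0; and (e, h)
    is a multiple of k^2 h^2 - z^2 = 0.  The vector u
    serves to detect that transvections along e are nontrivial. *)
Lemma isotropic_orthogonal (h : L) : Lnorm h <= 0 ->
  exists e u : L, [/\ Lnorm e = 0, Lform e h = 0, Lform u e <> 0 &
    forall s t, let b := s *: simple_root 7 + t *: simple_root 8 in
      Lform h b = 0 -> Lform e b = 0 /\ Lform u b = 0].
Proof.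
move=> h0; have delta2 : Lform delta delta = 0 by apply: norm_chain.
have delta7 : Lform delta (simple_root 7) = 0 by rewrite LformE !vec_coord.
have delta8 : Lform delta (simple_root 8) = 0 by rewrite LformE !vec_coord.
have delta_b s t : Lform delta (s *: simple_root 7 + t *: simple_root 8) = 0.
  by rewrite !Lform_lin delta7 delta8; ring.
have [a0|/eqP a0] := eqVneq (Lform h delta) 0.
  exists delta, (chain 1); split=> //; first by rewrite LformC.
    by rewrite LformE !vec_coord.
  move=> s t b hb; split; first exact: delta_b.
  rewrite /b !Lform_lin.
  have -> : Lform (chain 1) (simple_root 7) = 0 by rewrite LformE !vec_coord.
  have -> : Lform (chain 1) (simple_root 8) = 0 by rewrite LformE !vec_coord.
  by ring.
have [k k0 [z [z2 zd z7 z8]]] := E8_rational_norms `|Lnorm h|.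
have {}z2 : Lform z z = k%:Z ^+ 2 * Lform h h.
  by rewrite -!/(Lnorm _) z2; move: h0; clear; lia.
pose w := k%:Z *: h + z.
have wd : Lform w delta = k%:Z * Lform h delta by rewrite !Lform_lin zd addr0.
have w2 : Lnorm w = 2 * k%:Z ^+ 2 * Lform h h + 2 * k%:Z * Lform h z.
  by rewrite /Lnorm !Lform_lin z2 (LformC z h); ring.
have wh : Lform w h = k%:Z * Lform h h + Lform h z.
  by rewrite !Lform_lin (LformC z h).
have w_b s t : let b := s *: simple_root 7 + t *: simple_root 8 in
    Lform h b = 0 -> Lform w b = 0.
  by move=> b hb; rewrite LformDl LformZl hb /b !Lform_lin z7 z8; ring.
clearbody w; exists (2 * Lform w delta *: w - Lnorm w *: delta), delta.
split.
- rewrite /Lnorm -scaleNr !Lform_lin -/(Lnorm w) delta2 (LformC delta w); ring.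
- by rewrite -scaleNr !Lform_lin wd wh w2 (LformC delta h); ring.
- rewrite -scaleNr LformDr !LformZr delta2 (LformC delta w) wd => /eqP.
  rewrite mulr0 addr0 !mulf_eq0 !orbb; case/orP => // /orP[] /eqP //.
  by move: k0; clear; lia.
- move=> s t b hb; split; last exact: delta_b.
  rewrite -scaleNr LformDl !LformZl delta_b.
  by rewrite w_b //; ring.
Qed.

(** Some nonzero combination b of the roots 7 and 8 is orthogonal to h, so the
    transvection of e and b fixes h.  If it were trivial, pairing its value at u
    with u would give 2 b^2 (u, e)^2 = 0, while these roots span a negative
    definite plane. *)
Lemma nonpositive_stabilizer (h : L) : Lnorm h <= 0 -> ~ trivial_stabilizer h.
Proof.
move=> /isotropic_orthogonal [e [u [e0 eh ue orth]]] triv.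
have [s [t [st0 hb]]] : exists s t : int, (s != 0) || (t != 0) /\
    Lform h (s *: simple_root 7 + t *: simple_root 8) = 0.
  have [h7|h7] := eqVneq (Lform h (simple_root 7)) 0.
    by exists 1, 0; split=> //; rewrite !Lform_lin h7; ring.
  exists (- Lform h (simple_root 8)), (Lform h (simple_root 7)).
  by rewrite h7 orbT; split=> //; rewrite !Lform_lin; ring.
have [eb ub] := orth s t hb; set b : L := _ + _ in hb eb ub.
have fix_h : transvection e b h = h.
  rewrite /transvection (LformC h e) eh hb !mulr0 addr0 !scale0r.
  by rewrite subr0 addr0.
have fix_u := triv _ (in_OL_transvection _ _ e0 eb) fix_h u.
have b0 : Lnorm b = 0.
  have := Lform_transvection e b u u.
  rewrite fix_u ub (LformC b u) ub (LformC e u).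
  move=> eq_u; have /eqP : Lnorm b * (Lform u e) ^+ 2 = 0.
    by move: eq_u; clear; lia.
  by rewrite mulf_eq0 expf_eq0 /= => /orP[/eqP|/eqP/ue].
have bE : Lnorm b = - 2 * (s ^+ 2 - s * t + t ^+ 2).
  rewrite Lnorm_comb !norm_simple_root //.
  have -> : Lform (simple_root 7) (simple_root 8) = 1.
    by rewrite LformE !vec_coord.
  by ring.
have sq : (2 * s - t) ^+ 2 + 3 * t ^+ 2 = 0.
  transitivity (- 2 * Lnorm b); last by rewrite b0.
  by rewrite bE; ring.
have t0 : t = 0.
  by apply: sqr_le0; move: (sqr_ge0 (2 * s - t)) sq; clear; lia.
have s0 : s = 0.
  by apply: sqr_le0; move: sq; rewrite t0; clear; lia.
by move: st0; rewrite s0 t0.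
Qed.

(** * Vectors with trivial stabilizer *)

(** As labels are integers, h - rho is again dominant. *)
Lemma weyl_vector_minimal (h : L) :
  dominant h -> (forall i, (i < 10)%N -> label h i <> 0) ->
  1240 <= Lnorm h /\ (Lnorm h = 1240 -> h = weyl_vector).
Proof.
move=> dh h0; pose d := h + -1 *: weyl_vector.
have dom_rho : dominant weyl_vector.
  by move=> i i10; rewrite /label LformC -/(height _) height_simple_root.
have dd : dominant d.
  move=> i i10; rewrite /label !Lform_lin -/(label h i).
  rewrite (LformC weyl_vector) -/(height _) height_simple_root //.
  by move: (dh i i10) (h0 i i10); clear; lia.
have hE : Lnorm h = 1240 + 2 * height d + Lnorm d.
  have -> : h = 1 *: weyl_vector + 1 *: d.
    by rewrite !scale1r /d scaleN1r addrC subrK.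
  rewrite Lnorm_comb norm_weyl_vector (LformC weyl_vector) -/(height d).
  by ring.
have d2 : 0 <= Lnorm d by apply: dominant_Lform_ge0.
have hd : 0 <= height d by apply: dominant_Lform_ge0.
split; first by move: d2 hd; rewrite hE; clear; lia.
move=> h1240; have d0 : d = 0.
  by apply: dominant_height_lt30 => //;
     move: h1240 d2 hd; rewrite hE; clear; lia.
by apply/eqP; rewrite -subr_eq0 -scaleN1r -/d d0.
Qed.

(** The reflection in a root orthogonal to h fixes h. *)
Lemma trivial_stabilizer_label (h : L) : trivial_stabilizer h ->
  forall i, (i < 10)%N -> label h i <> 0.
Proof.
move=> triv i i10 hi; set r := simple_root i.
have r2 : Lnorm r = - 2 by apply: norm_simple_root.
have rh : reflection r h = h.
  by rewrite /reflection -/(label h i) hi scale0r addr0.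
have := triv _ (in_OL_reflection r r2) rh r.
move/(congr1 height).
by rewrite heightD heightZ -/(Lnorm r) r2 height_simple_root.
Qed.

Lemma trivial_stabilizer_orbit (h : L) : trivial_stabilizer h ->
  1240 <= Lnorm h /\
  (Lnorm h = 1240 -> exists g : {linear L -> L}, in_OL g /\ g h = weyl_vector).
Proof.
move=> triv; have h2 : 0 < Lnorm h.
  by rewrite ltNge; apply/negP => /nonpositive_stabilizer.
have [f [Of ff]] : exists f : {linear L -> L}, in_OL f /\ forward (f h).
  have [hlt|hgt|h0] := ltgtP 0 (height h).
  - exists idfun; split; last by split=> //; apply: ltW.
    by split=> //; exists idfun.
  - exists (-%R : {linear L -> L}); split; first exact: in_OL_opp.
    split; first by rewrite /Lnorm (in_OL_opp.2) ltW.
    by rewrite /= -scaleN1r heightZ mulN1r oppr_gt0.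
  - have hz : h = 0 by apply: height_eq0; [exact: ltW|].
    by move: h2; rewrite hz /Lnorm LformE !mxE.
have [g [Og _ dg _]] := forward_dominant _ ff.
have trivial_gfh := trivial_stabilizer_isometry _ _ Og
  (trivial_stabilizer_isometry _ _ Of triv).
have [] := weyl_vector_minimal _ dg (trivial_stabilizer_label _ trivial_gfh).
have -> : Lnorm (g (f h)) = Lnorm h by rewrite /Lnorm Og.2 Of.2.
move=> min uniq; split=> // /uniq gfh.
by exists (g \o f); split=> //; apply: in_OL_comp.
Qed.

Theorem theorem3p1 :
  (exists h : L, trivial_stabilizer h /\ Lnorm h = 1240) /\
  (forall h : L, trivial_stabilizer h -> 1240 <= Lnorm h) /\
  (forall h h' : L,
     trivial_stabilizer h -> Lnorm h = 1240 ->
     trivial_stabilizer h' -> Lnorm h' = 1240 ->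
     exists g : {linear L -> L}, in_OL g /\ g h = h').
Proof.
split.
  exists weyl_vector; split; last exact: norm_weyl_vector.
  exact: weyl_vector_stabilizer.
split=> [h /trivial_stabilizer_orbit[] // | h h' th nh th' nh'].
have [_ /(_ nh)[g [Og gh]]] := trivial_stabilizer_orbit h th.
have [_ /(_ nh')[g' [Og' gh']]] := trivial_stabilizer_orbit h' th'.
have [f [Of g'K _]] := in_OL_inv _ Og'.
exists (f \o g); split; first exact: in_OL_comp.
by rewrite /= gh -gh' g'K.
Qed.
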